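(* The limit space $\mathcal J_{\mathcal H}$ of the self-similar group $\mathcal H$ is homeomorphic to the direct product $\mathbb C/\mathcal H\times\{\mathtt L,\mathtt R\}^{-\omega}$, by a homeomorphism under which the shift map $\mathsf s:\mathcal J_{\mathcal H}\to\mathcal J_{\mathcal H}$ acts by the rule $$\mathsf s(z,\ldots y_2y_1)=\begin{cases}((1-i)z,\ldots y_3y_2), & \text{if } y_1=\mathtt L,\\ ((1+i)z,\ldots y_3y_2), & \text{if } y_1=\mathtt R,\end{cases}$$ where $z$, $(1-i)z$, $(1+i)z$ are complex numbers representing the corresponding points of $\mathbb C/\mathcal H$.
   Context: $\mathcal H$ is the group of affine transformations of $\mathbb C$ of the form $z\mapsto\pm z+q$, $q\in\mathbb Z[i]$, acting on $\mathbb C$ from the right. Its self-similarity biset is $\mathfrak M=\{\mathtt x_1,\mathtt x_2,\mathtt x_3,\mathtt x_4\}\cdot\mathcal H$, the disjoint union of $\{\mathtt x_1,\mathtt x_2\}\cdot\mathcal H$ and $\{\mathtt x_3,\mathtt x_4\}\cdot\mathcal H$, where the $\mathtt x_k$ are the affine maps $z\cdot\mathtt x_1=\frac{1-i}{2}z$, $z\cdot\mathtt x_2=-\frac{1-i}{2}z+\frac{1+i}{2}$, $z\cdot\mathtt x_3=\frac{1+i}{2}z$, $z\cdot\mathtt x_4=-\frac{1+i}{2}z+\frac{1+i}{2}$, and the left and right actions of $\mathcal H$ are by pre- and post-composition, $z\cdot(g\cdot \mathtt x\cdot h)=((z\cdot g)\cdot\mathtt x)\cdot h$. For $g\in\mathcal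 H$ and $\mathtt x_k$ there are unique $\mathtt x_l$ and $g|_{\mathtt x_k}\in\mathcal H$ with $g\cdot\mathtt x_k=\mathtt x_l\cdot g|_{\mathtt x_k}$ (with $\mathtt x_l$ in the same summand as $\mathtt x_k$); this defines an action of $\mathcal H$ on finite words over $X=\{\mathtt x_1,\dots,\mathtt x_4\}$ by $g(\mathtt x_kv)=\mathtt x_l\,g|_{\mathtt x_k}(v)$. The limit space $\mathcal J_{\mathcal H}$ is the quotient of $X^{-\omega}$ (left-infinite sequences, product topology) by the asymptotic equivalence relation: $\ldots x_2x_1\sim\ldots y_2y_1$ iff there is a sequence $g_n\in\mathcal H$ taking finitely many values with $g_n(x_n\ldots x_1)=y_n\ldots y_1$ for all $n$. The map $\mathsf s$ is induced by the shift $\ldots x_2x_1\mapsto\ldots x_3x_2$. $\{\mathtt L,\mathtt R\}^{-\omega}$ is the space of left-infinite sequences over a two-letter alphabet. *)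

(* Defs.v *)
(* The plane C is [R[i]] for [R : realType]; its topology is the one of the
   norm, carried by the regular algebra [R[i]^o]. *)
From HB Require Import structures.
From mathcomp Require Import all_boot all_order all_algebra.
From mathcomp Require Import complex ring lra zify.
From mathcomp Require Import all_classical all_reals all_analysis.

Set Implicit Arguments.
Unset Strict Implicit.
Unset Printing Implicit Defensive.

Import Order.TTheory GRing.Theory Num.Theory.
Import numFieldNormedType.Exports.

Local Open Scope classical_set_scope.
Local Open Scope ring_scope.
Local Open Scope complex_scope.
Local Open Scope quotient_scope.

Definition gauss_int (R : realType) (z : R[i]) : bool :=
  (complex.Re z \is a Num.int) && (complex.Im z \is a Num.int).

Definition is_affH (R : realType) (f : R[i] -> R[i]) : Prop :=
  exists (s : bool) (q : R[i]),
    gauss_int q /\ f = (fun z : R[i] => (-1) ^+ s * z + q).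

(* The group H. The right action z . g of the group on the plane is the
   application [g z]. *)
Record affH (R : realType) : Type := AffH {
  affH_map :> R[i] -> R[i];
  affH_mapP : `[< is_affH affH_map >] }.

HB.instance Definition _ (R : realType) := [isSub for @affH_map R].
HB.instance Definition _ (R : realType) := [Choice of affH R by <:].

Section Group.
Variable R : realType.
Implicit Types (g h : affH R) (z q : R[i]) (s : bool).

Lemma affH_ext g h : g =1 h -> g = h.
Proof. by move=> gh; apply/val_inj/funext. Qed.

Lemma gauss_int0 : gauss_int (0 : R[i]).
Proof. by rewrite /gauss_int /= rpred0. Qed.

Lemma gauss_intD z q : gauss_int z -> gauss_int q -> gauss_int (z + q).
Proof.
case: z q => a b [c d] /andP[/= ha hb] /andP[/= hc hd].
by rewrite /gauss_int /= !rpredD.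
Qed.

Lemma gauss_intN z : gauss_int z -> gauss_int (- z).
Proof.
by case: z => a b /andP[/= ha hb]; rewrite /gauss_int /= !rpredN ha.
Qed.

Lemma gauss_int_sign s z : gauss_int z -> gauss_int ((-1) ^+ s * z).
Proof. by case: s; rewrite ?mulN1r ?mul1r //; exact: gauss_intN. Qed.

Lemma mk_affH_subproof s q : gauss_int q ->
  `[< is_affH (fun z : R[i] => (-1) ^+ s * z + q) >].
Proof. by move=> hq; apply/asboolP; exists s, q. Qed.

Definition mk_affH s q (hq : gauss_int q) : affH R :=
  AffH (mk_affH_subproof s hq).

Lemma affHP g : exists s q (hq : gauss_int q), g = mk_affH s hq.
Proof.
have /asboolP[s [q [hq e]]] := affH_mapP g.
by exists s, q, hq; apply/affH_ext => z; rewrite e.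
Qed.

Definition affH_one : affH R := mk_affH false gauss_int0.

Lemma affH_mul_subproof g h : `[< is_affH (h \o g) >].
Proof.
have [s [q [hq ->]]] := affHP g; have [t [r [hr ->]]] := affHP h.
apply/asboolP; exists (s (+) t), ((-1) ^+ t * q + r); split.
  exact/gauss_intD/hr/gauss_int_sign.
by apply/funext => z /=; rewrite signr_addb; ring.
Qed.

(* Right action: in the product [g * h], the map [g] is applied first. *)
Definition affH_mul g h : affH R := AffH (affH_mul_subproof g h).

Lemma affH_inv_subproof g : exists h : affH R, cancel g h /\ cancel h g.
Proof.
have [s [q [hq ->]]] := affHP g.
exists (mk_affH s (gauss_intN (gauss_int_sign s hq))).
by split=> z /=; case: s; rewrite ?expr1 ?expr0; ring.
Qed.

Definition affH_inv g : affH R := projT1 (cid (affH_inv_subproof g)).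

Lemma affH_invK g : cancel g (affH_inv g).
Proof. by rewrite /affH_inv; case: cid => h []. Qed.

Lemma affH_invKV g : cancel (affH_inv g) g.
Proof. by rewrite /affH_inv; case: cid => h []. Qed.

Lemma affH_mulA : associative affH_mul.
Proof. by move=> f g h; apply: affH_ext. Qed.

Lemma affH_mul1 : left_id affH_one affH_mul.
Proof. by move=> g; apply: affH_ext => z /=; rewrite expr0 mul1r addr0. Qed.

Lemma affH_1mul : right_id affH_one affH_mul.
Proof. by move=> g; apply: affH_ext => z /=; rewrite expr0 mul1r addr0. Qed.

Lemma affH_mulV : left_inverse affH_one affH_inv affH_mul.
Proof.
by move=> g; apply: affH_ext => z /=; rewrite affH_invKV expr0 mul1r addr0.
Qed.

Lemma affH_Vmul : right_inverse affH_one affH_inv affH_mul.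
Proof.
by move=> g; apply: affH_ext => z /=; rewrite affH_invK expr0 mul1r addr0.
Qed.

HB.instance Definition _ := isGroup.Build (affH R)
  affH_mulA affH_mul1 affH_1mul affH_mulV affH_Vmul.

End Group.

(* The letters x_1, x_2, x_3, x_4 are the ordinals 0, 1, 2, 3 of ['I_4]. *)
Definition letter_map (R : realType) (k : 'I_4) (z : R[i]) : R[i] :=
  match val k with
  | 0 => (1 - 'i) / 2 * z
  | 1 => - ((1 - 'i) / 2) * z + (1 + 'i) / 2
  | 2 => (1 + 'i) / 2 * z
  | _ => - ((1 + 'i) / 2) * z + (1 + 'i) / 2
  end.

(* The left and right actions of H on maps of the plane, in right-action
   notation: z . (g . m) = (z . g) . m and z . (m . h) = (z . m) . h.
   The biset consists of the maps [ract (letter_map k) h]. *)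
Definition lact (R : realType) (g : affH R) (m : R[i] -> R[i]) : R[i] -> R[i] :=
  fun z => m (g z).
Definition ract (R : realType) (m : R[i] -> R[i]) (h : affH R) : R[i] -> R[i] :=
  fun z => h (m z).

Section Biset.
Variable R : realType.
Implicit Types (g h : affH R) (k l : 'I_4).
Let X : 'I_4 -> R[i] -> R[i] := @letter_map R.

Let half (k : 'I_4) : bool := odd k.
Let typ (k : 'I_4) : bool := (2 <= k)%N.

Let sg (s : bool) : R := (-1) ^+ s.

Lemma letter_mapE k (x y : R) : letter_map k (x +i* y) =
  (sg (half k) * (x + sg (typ k) * y) / 2 + (half k)%:R / 2) +i*
  (sg (half k) * (y - sg (typ k) * x) / 2 + (half k)%:R / 2).
Proof.
have e2 : (2 : R[i])^-1 = (2^-1)%:C by rewrite fmorphV /= rmorph_nat.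
rewrite /letter_map /half /typ /sg e2.
case: k => [[|[|[|[|//]]]] i] /=; simpc; apply/eqP; rewrite eq_complex /=;
  apply/andP; split; apply/eqP; rewrite ?expr0 ?expr1 /=; lra.
Qed.

Lemma mk_affHE s (a b x y : R) (hq : gauss_int (a +i* b)) :
  mk_affH s hq (x +i* y) = (sg s * x + a) +i* (sg s * y + b).
Proof.
by rewrite /sg /=; case: s; rewrite ?expr0 ?expr1 ?mulN1r ?mul1r.
Qed.

Lemma affH_coordP g : exists (s : bool) (a b : int),
  forall x y : R, g (x +i* y) = (sg s * x + a%:~R) +i* (sg s * y + b%:~R).
Proof.
have [s [[a b] [hq ->]]] := affHP g.
have [/intrP[a' ea] /intrP[b' eb]] := andP hq.
by exists s, a', b' => x y; rewrite mk_affHE -ea -eb.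
Qed.

Let coord_affH (s : bool) (a b : int) : exists g : affH R,
  forall x y : R, g (x +i* y) = (sg s * x + a%:~R) +i* (sg s * y + b%:~R).
Proof.
have hq : gauss_int (a%:~R +i* b%:~R : R[i]) by rewrite /gauss_int /= !intr_int.
by exists (mk_affH s hq) => x y; rewrite mk_affHE.
Qed.

Let mkl (t u : bool) : 'I_4 :=
  match t, u with
  | false, false => @Ordinal 4 0 isT
  | false, true => @Ordinal 4 1 isT
  | true, false => @Ordinal 4 2 isT
  | true, true => @Ordinal 4 3 isT
  end.

Let mklK t u : (typ (mkl t u) = t) * (half (mkl t u) = u).
Proof. by case: t; case: u. Qed.

Let typ_half_inj k l : typ k = typ l -> half k = half l -> k = l.
Proof.
by case: k => [[|[|[|[|//]]]] ?]; case: l => [[|[|[|[|//]]]] ?] // _ _;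
  apply: val_inj.
Qed.

Let parity (n : int) : exists (p : bool) (m : int), n = m * 2 + p%:R.
Proof.
exists ((n %% 2)%Z != 0), (n %/ 2)%Z.
have := divz_eq n 2; have := ltz_pmod n (d := 2) isT.
have := modz_ge0 n (d := 2) isT; case: eqP => /= h; lia.
Qed.

Lemma biset_basis_ex g k : exists (l : 'I_4) (h : affH R),
  typ l = typ k /\ lact g (letter_map k) = ract (letter_map l) h.
Proof.
have [s [a [b eg]]] := affH_coordP g.
have [p [m em]] := parity (a + b).
pose t := half k; pose w := typ k; pose s' := s (+) p.
pose u : int := if w then a - m - p%:R else m.
pose v : int := if w then m else m - a.
pose r : int := ((t (+) p) && s')%:R.
have [h eh] := coord_affH s' ((-1) ^+ t * u + r) ((-1) ^+ t * v + r).
exists (mkl w (t (+) p)), h; split; first by rewrite mklK.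
apply/funext => -[x y]; rewrite /lact /ract eg !letter_mapE eh !mklK -/t -/w.
have -> : b = m * 2 + p%:R - a by rewrite -em; ring.
rewrite /r /s' /u /v /sg; clear h eh r u v s' em eg; clearbody t w.
apply/eqP; rewrite eq_complex /=; apply/andP; split; apply/eqP;
  case: t; case: w; case: p; case: s => /=;
  rewrite ?expr0 ?expr1 ?(rmorphN, rmorphD, rmorphM, rmorph_nat,
   rmorph1, rmorph0, rmorphB) /=; lra.
Qed.

Let half_int (s s' : bool) (a a' : int) (t t' : bool) :
  sg s * (t%:R / 2) + a%:~R = sg s' * (t'%:R / 2) + a'%:~R -> t = t'.
Proof.
move=> e; apply: contra_eq (erefl (0 : int)) => tt'.
have : ((-1) ^+ s * t%:R + 2 * a)%:~R = ((-1) ^+ s' * t'%:R + 2 * a')%:~R :> R.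
  rewrite !(rmorphD, rmorphM, rmorphXn, rmorphN, rmorph_nat, rmorph1) /=.
  move: e; rewrite /sg; lra.
move/eqP; rewrite eqr_int => /eqP.
by move: tt'; case: t {e}; case: t' => //= _; case: s; case: s' => /=; lia.
Qed.

Lemma biset_free k l g h :
  ract (letter_map k) g = ract (letter_map l) h -> k = l /\ g = h.
Proof.
have [s [a [b eg]]] := affH_coordP g; have [s' [a' [b' eh]]] := affH_coordP h.
move=> e.
have := congr1 (fun f => f (0 +i* 0)) e; rewrite /ract !letter_mapE eg eh.
have := congr1 (fun f => f (1 +i* 0)) e; rewrite /ract !letter_mapE eg eh.
rewrite !mulr0 !addr0 !subr0 !mulr0 !mul0r !add0r !mulr1.
move=> [e1 e2] [e3 e4].
have et : half k = half l by exact: half_int e3.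
have ew : typ k = typ l.
  move: e1 e2 e3 e4; rewrite -et /sg.
  by case: (half k); case: (typ k); case: (typ l); case: s {eg};
    case: s' {eh} => //=; rewrite ?expr0 ?expr1; lra.
have es : s = s'.
  move: e1 e2 e3 e4; rewrite -et -ew /sg.
  by case: (half k); case: (typ k); case: s {eg};
    case: s' {eh} => //=; rewrite ?expr0 ?expr1; lra.
split; first exact: typ_half_inj.
have ea : a%:~R = a'%:~R :> R by move: e3; rewrite et es; lra.
have eb : b%:~R = b'%:~R :> R by move: e4; rewrite et es; lra.
by apply: affH_ext => -[x y]; rewrite eg eh es ea eb.
Qed.

End Biset.

(* Existence and uniqueness of x_l and g|_(x_k) in g . x_k = x_l . g|_(x_k). *)
Lemma biset_basis (R : realType) (g : affH R) (k : 'I_4) :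
  exists! p : 'I_4 * affH R,
    lact g (letter_map k) = ract (letter_map p.1) p.2.
Proof.
have [l [h [_ e]]] := biset_basis_ex g k.
exists (l, h); split=> // -[l' h'] /= e'.
by have [-> ->] := biset_free (etrans (esym e) e').
Qed.

Definition wreath (R : realType) (g : affH R) (k : 'I_4) : 'I_4 * affH R :=
  projT1 (cid (biset_basis g k)).
Notation perm_letter g k := (wreath g k).1.
Notation restr_at g k := (wreath g k).2.

Lemma wreathP (R : realType) (g : affH R) (k : 'I_4) :
  lact g (letter_map k) = ract (letter_map (perm_letter g k)) (restr_at g k).
Proof. by rewrite /wreath; case: cid => p []. Qed.

Lemma wreath_uniq (R : realType) (g : affH R) (k l : 'I_4) (h : affH R) :
  lact g (letter_map k) = ract (letter_map l) h -> wreath g k = (l, h).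
Proof.
by move=> e; have [el eh] := biset_free (etrans (esym (wreathP g k)) e);
  rewrite -el -eh -surjective_pairing.
Qed.

Lemma wreath_summand (R : realType) (g : affH R) (k : 'I_4) :
  (perm_letter g k < 2)%N = (k < 2)%N.
Proof.
have [l [h [tl e]]] := biset_basis_ex g k; rewrite (wreath_uniq e) /=.
by apply: negb_inj; rewrite -!leqNgt.
Qed.

(* The word x_n ... x_1 is the list [:: x_n; ...; x_1]. *)
Fixpoint word_act (R : realType) (g : affH R) (v : seq 'I_4) : seq 'I_4 :=
  if v is k :: v' then perm_letter g k :: word_act (restr_at g k) v' else [::].

Section Action.
Variable R : realType.
Implicit Types (g h : affH R) (v w : seq 'I_4).

Lemma wreath1 k : wreath (1%g : affH R) k = (k, 1%g).
Proof.
by apply: wreath_uniq; apply/funext => z;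
  rewrite /lact /ract /= !expr0 !mul1r !addr0.
Qed.

Lemma wreathM g h k : wreath (g * h)%g k =
  (perm_letter g (perm_letter h k), (restr_at g (perm_letter h k) * restr_at h k)%g).
Proof.
apply: wreath_uniq; apply/funext => z.
have eh := congr1 (fun f => f (g z)) (wreathP h k).
have eg := congr1 (fun f => f z) (wreathP g (perm_letter h k)).
by move: eg eh; rewrite /lact /ract /= => -> ->.
Qed.

Lemma word_act1 v : word_act (1%g : affH R) v = v.
Proof. by elim: v => //= k v IH; rewrite wreath1 /= IH. Qed.

Lemma word_actM g h v : word_act (g * h)%g v = word_act g (word_act h v).
Proof. by elim: v g h => //= k v IH g h; rewrite wreathM /= IH. Qed.

Lemma word_actK g v : word_act g^-1%g (word_act g v) = v.
Proof. by rewrite -word_actM mulVg word_act1. Qed.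

Lemma word_act_size g v : size (word_act g v) = size v.
Proof. by elim: v g => //= k v IH g; rewrite IH. Qed.

Lemma word_act_rcons g v k :
  exists l, word_act g (rcons v k) = rcons (word_act g v) l.
Proof.
elim: v g => [|j v IH] g /=; first by exists (perm_letter g k).
by have [l ->] := IH (restr_at g j); exists l.
Qed.

End Action.

(* Left-infinite sequences ... y_2 y_1 over a discrete alphabet, with the
   product topology; the letter y_(n+1) is the value [y n]. *)
Definition left_inf (A : choiceType) : topologicalType :=
  {ptws nat -> discrete_topology A}.

Definition seq_shift (A : choiceType) (y : left_inf A) : left_inf A :=
  fun n => y n.+1.

(* The word y_n ... y_2 y_1. *)
Definition word (A : choiceType) (y : left_inf A) (n : nat) : seq A :=
  rev (mkseq y n).

Definition asymp (R : realType) (x y : left_inf 'I_4) : bool :=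
  `[< exists g : nat -> affH R, finite_set (range g) /\
        forall n, word_act (g n) (word x n) = word y n >].

Section Limit.
Variable R : realType.

Lemma asymp_refl : reflexive (@asymp R).
Proof.
move=> x; apply/asboolP; exists (fun=> 1%g); split; last first.
  by move=> n; rewrite word_act1.
by apply: (sub_finite_set _ (finite_set1 (1%g : affH R))) => _ [n _ <-].
Qed.

Lemma asymp_sym : symmetric (@asymp R).
Proof.
suff H x y : asymp R x y -> asymp R y x by move=> x y; apply/idP/idP; apply: H.
move=> /asboolP[g [fg e]]; apply/asboolP; exists (fun n => (g n)^-1%g); split.
  apply: (sub_finite_set _ (finite_image (fun h => h^-1%g) fg)).
  by move=> _ [n _ <-] /=; exists (g n) => //; exists n.
by move=> n; rewrite -e word_actK.
Qed.

Lemma asymp_trans : transitive (@asymp R).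
Proof.
move=> y x z /asboolP[g [fg eg]] /asboolP[h [fh eh]]; apply/asboolP.
exists (fun n => (h n * g n)%g); split.
  apply: (sub_finite_set _ (finite_image2 (fun a b => (a * b)%g) fh fg)).
  by move=> _ [n _ <-] /=; exists (h n); [exists n|exists (g n) => //; exists n].
by move=> n; rewrite word_actM eg eh.
Qed.

Canonical asymp_equiv := EquivRel (@asymp R) asymp_refl asymp_sym asymp_trans.

Definition limit_space : topologicalType :=
  quotient_topology {eq_quot asymp_equiv}.

Definition limit_shift (p : limit_space) : limit_space :=
  \pi_limit_space (seq_shift (repr p)).

Lemma word_S (A : choiceType) (y : left_inf A) n :
  word y n.+1 = rcons (word (seq_shift y) n) (y 0).
Proof. by rewrite /word /mkseq /= (iotaDl 1 0) -map_comp rev_cons. Qed.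

Lemma asymp_shift x y : asymp R x y -> asymp R (seq_shift x) (seq_shift y).
Proof.
move=> /asboolP[g [fg e]]; apply/asboolP; exists (fun n => g n.+1); split.
  by apply: (sub_finite_set _ fg) => _ [n _ <-]; exists n.+1.
move=> n; have := e n.+1; rewrite !word_S.
have [l ->] := word_act_rcons (g n.+1) (word (seq_shift x) n) (x 0).
by move/rcons_inj => [].
Qed.

(* [limit_shift] is the map induced by the shift. *)
Lemma limit_shiftE (x : left_inf 'I_4) :
  limit_shift (\pi_limit_space x) = \pi_limit_space (seq_shift x).
Proof.
apply/eqmodP/asymp_shift.
by have /eqmodP := reprK (\pi_limit_space x).
Qed.

Definition orbit_rel (z w : R[i]^o) : bool :=
  `[< exists g : affH R, g z = w >].

Lemma orbit_refl : reflexive orbit_rel.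
Proof.
by move=> z; apply/asboolP; exists 1%g; rewrite /= expr0 mul1r addr0.
Qed.

Lemma orbit_sym : symmetric orbit_rel.
Proof.
suff H z w : orbit_rel z w -> orbit_rel w z by move=> z w; apply/idP/idP; apply: H.
by move=> /asboolP[g <-]; apply/asboolP; exists g^-1%g; apply: affH_invK.
Qed.

Lemma orbit_trans : transitive orbit_rel.
Proof.
move=> w z u /asboolP[g <-] /asboolP[h <-]; apply/asboolP.
by exists (g * h)%g.
Qed.

Canonical orbit_equiv := EquivRel orbit_rel orbit_refl orbit_sym orbit_trans.

Definition orbit_space : topologicalType :=
  quotient_topology {eq_quot orbit_equiv}.

End Limit.

Definition homeomorphism (S T : topologicalType) (f : S -> T) : Prop :=
  continuous f /\
  exists g : T -> S, [/\ continuous g, cancel f g & cancel g f].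

(* The two-letter alphabet {L, R} is [bool]. *)
Definition letterL : bool := false.
Definition letterR : bool := true.

(* Main.v *)
Require Import Defs.
From HB Require Import structures.
From mathcomp Require Import all_boot all_order all_algebra.
From mathcomp Require Import complex ring lra zify.
From mathcomp Require Import all_classical all_reals all_analysis.
Import Order.TTheory GRing.Theory Num.Theory.
Import numFieldNormedType.Exports.
Local Open Scope classical_set_scope.
Local Open Scope ring_scope.
Local Open Scope complex_scope.
Local Open Scope quotient_scope.

(** A left-infinite word ... x_2 x_1 is read as the point
    lim_n ((0 . x_n) . x_(n-1)) ... . x_1 of the plane. Every letter is a
    similarity of ratio 1 / sqrt 2, so the limit exists, and the resulting
    [coded_point] is a bounded solution of
    [coded_point x = letter_map (x 0) (coded_point (seq_shift x))]. Recording
    next to its class modulo H the sequence of summands ({x_1, x_2} or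
    {x_3, x_4}) of the letters gives a map [coding] from words to the product of
    the orbit space and the Cantor set, and the homeomorphism is induced by it.

    Its fibres are the asymptotic classes. If x and y are asymptotic through
    g_n, then the points coded by x and by some h_n . y differ by 2^(-n/2)
    times a bounded quantity; since the orbits of H are discrete, the two points
    lie in one orbit ([asymp_orbit]). Conversely, for letters x_k and
    x_l of one summand and h in H the map x_l . h . x_k^-1 lies in H
    ([lift_letter]), because multiplication by 1 + i and by 1 - i preserves
    the Gaussian integers; so an element h that maps the point of y to the point
    of x can be lifted along the two words level by level. The lifts match
    points of the bounded set of coded points, hence are finitely many
    ([orbit_asymp], [affH_bounded_finite]).

    The coding is continuous, its source is compact and its target is
    Hausdorff, so its range is closed. The range is dense: every z is the
    image under a word of length n of some point, which an element of H moves
    into a bounded set, and moving that element through the word changes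
    neither the summands nor, modulo H, the value ([coded_point_dense]). So the
    induced map is a continuous bijection from a compact space to a Hausdorff
    space.

    Finally x_1 and x_2 are, up to elements of H, division by 1 + i, and x_3
    and x_4 division by 1 - i. Therefore deleting the letter x_1 of a word
    multiplies the coded orbit by 1 + i or 1 - i according to the summand, which
    is the asserted rule with R for {x_1, x_2} and L for {x_3, x_4}. *)

Set Implicit Arguments.
Unset Strict Implicit.
Unset Printing Implicit Defensive.

(** * Letters, words and the group H *)

Section Letters.
Variable R : realType.
Implicit Types (g h : affH R) (z w q : R[i]) (k l : 'I_4).

(** The norm of [R[i]] takes its values in [R[i]]; estimates are made with this
    real-valued squared modulus, which every letter divides by exactly 2. *)
Definition sqn z : R := complex.Re z ^+ 2 + complex.Im z ^+ 2.

(** [true] stands for the summand of the letters x_1 and x_2. *)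
Definition side k : bool := (k < 2)%N.

Definition dilation (b : bool) : R[i] := if b then 1 + 'i else 1 - 'i.

Lemma invC2 : (2 : R[i])^-1 = (2^-1)%:C.
Proof. by rewrite fmorphV /= rmorph_nat. Qed.

Lemma sqn_ge0 z : 0 <= sqn z.
Proof. by rewrite addr_ge0 ?sqr_ge0. Qed.

Lemma sqnN z : sqn (- z) = sqn z.
Proof. by case: z => a b; rewrite /sqn /= !sqrrN. Qed.

Lemma sqnB_le z w : sqn (z - w) <= 2 * sqn z + 2 * sqn w.
Proof.
case: z w => a b [c d]; rewrite /sqn /=.
have := sqr_ge0 (a + c); have := sqr_ge0 (b + d); nra.
Qed.

Lemma sqn_letterB k z w :
  sqn (letter_map k z - letter_map k w) = sqn (z - w) / 2.
Proof.
case: z w => a b [c d]; rewrite /letter_map invC2 /sqn.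
by case: k => [[|[|[|[|//]]]] i] /=; simpc => /=; field.
Qed.

(** A disk about 0 of radius r is mapped into itself by all letters as soon as
    r >= 1 + sqrt 2, since (r + 1) / sqrt 2 <= r; the radius 3 is used
    throughout. *)
Lemma sqn_letter k z : sqn z <= 9 -> sqn (letter_map k z) <= 9.
Proof.
case: z => a b; rewrite /letter_map invC2 /sqn.
case: k => [[|[|[|[|//]]]] i] /=; simpc => /= h; nra.
Qed.

Lemma dilation_neq0 b : dilation b != 0.
Proof. by case: b; rewrite eq_complex /= negb_and ?addr0 ?subr0 oner_eq0. Qed.

Lemma gauss_int_dilation b q : gauss_int q -> gauss_int (dilation b * q).
Proof.
case: q => x y /andP[/= hx hy]; rewrite /gauss_int /dilation.
by case: b; simpc; rewrite /= ?rpredB ?rpredD ?rpredN.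
Qed.

(** Conjugation by a multiplication only multiplies the translation part, here
    by a Gaussian integer. *)
Lemma dilation_affH b g :
  exists h, forall z, dilation b * g z = h (dilation b * z).
Proof.
have [s [q [hq ->]]] := affHP g.
exists (mk_affH s (gauss_int_dilation b hq)) => z /=.
by rewrite mulrDr mulrCA.
Qed.

(** Up to H, a letter is the division by [dilation] of its summand, because
    (1 + i) / 2 times 1 + i or 1 - i is i or 1. *)
Lemma dilation_letter k :
  exists g, forall z, dilation (side k) * letter_map k z = g z.
Proof.
pose q : R[i] := (odd k)%:R * (if side k then 'i else 1).
have hq : gauss_int q.
  rewrite /q /gauss_int; case: (odd k); case: (side k);
  by rewrite ?mul1r ?mul0r /= ?rpred0 ?rpred1.
exists (mk_affH (odd k) hq) => -[x y] /=.
rewrite /dilation /q /letter_map /side invC2.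
case: k q hq => [[|[|[|[|//]]]] i] _ _ /=; simpc; apply/eqP;
  rewrite eq_complex /=; apply/andP; split; apply/eqP; by field.
Qed.

Lemma letter_surj k w : exists z, letter_map k z = w.
Proof.
have [g eg] := dilation_letter k; exists (g^-1%g (dilation (side k) * w)).
by apply: (mulfI (dilation_neq0 (side k))); rewrite eg affH_invKV.
Qed.

Lemma letter_inj k : injective (@letter_map R k).
Proof.
have [g eg] := dilation_letter k => z w e.
by apply: (can_inj (affH_invK g)); rewrite -!eg e.
Qed.

(** The converse of restriction: [biset_basis] computes h from g and the
    letter, whereas here h and both letters are given. The lift g is
    letter_l h letter_k^-1, and after multiplication by the common
    [dilation] of the two letters all three factors are in H. *)
Lemma lift_letter h k l : side k = side l ->
  exists g, forall z, letter_map k (g z) = h (letter_map l z).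
Proof.
move=> kl; have [u eu] := dilation_letter k; have [v ev] := dilation_letter l.
have [h' eh'] := dilation_affH (side k) h.
exists (v * h' * u^-1)%g => z; apply: (mulfI (dilation_neq0 (side k))).
by rewrite eu eh' kl ev /= affH_invKV.
Qed.

Lemma side_perm_letter g k : side (wreath g k).1 = side k.
Proof. exact: wreath_summand. Qed.

Lemma sqn_affH g z w : sqn (g z - g w) = sqn (z - w).
Proof.
have [s [q [hq ->]]] := affHP g; case: z w => a b [c d] /=.
rewrite /sqn; case: s; case: q hq => x y _; rewrite ?expr0 ?expr1;
  by simpc => /=; ring.
Qed.

(** The letter at the head of the list, x_n in x_n ... x_1, is applied first, in
    agreement with the right action. *)
Definition weval (v : seq 'I_4) z : R[i] :=
  foldl (fun w k => letter_map k w) z v.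

Lemma weval_surj v w : exists z, weval v z = w.
Proof.
elim/last_ind: v w => [|v k IH] w; first by exists w.
have [u <-] := letter_surj k w; have [z <-] := IH u.
by exists z; rewrite /weval foldl_rcons.
Qed.

Lemma sqn_weval v z w : sqn (weval v z - weval v w) = sqn (z - w) / 2 ^+ size v.
Proof.
elim: v z w => [|k v IH] z w /=; first by rewrite expr0 divr1.
by rewrite IH sqn_letterB exprS invfM mulrA.
Qed.

(** The witness h is the iterated restriction of g along v. *)
Lemma weval_act g v :
  exists h, forall z, weval v (g z) = h (weval (word_act g v) z).
Proof.
elim: v g => [|k v IH] g /=; first by exists g.
have [h eh] := IH (wreath g k).2; exists h => z.
by rewrite -eh; congr weval; exact: (congr1 (fun f => f z) (wreathP g k)).
Qed.

Lemma map_side_act g v : map side (word_act g v) = map side v.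
Proof. by elim: v g => //= k v IH g; rewrite IH side_perm_letter. Qed.

(** * Discreteness of the group H *)

Lemma gauss_int_intr (a b : int) : gauss_int (a%:~R +i* b%:~R : R[i]).
Proof. by rewrite /gauss_int /= !intr_int. Qed.

(** The translation part of such a g has both coordinates in [-6, 6]. *)
Lemma affH_bounded_finite :
  finite_set [set g : affH R | exists z, sqn z <= 9 /\ sqn (g z) <= 9].
Proof.
pose F (p : bool * ('I_13 * 'I_13)) : affH R :=
  mk_affH p.1 (gauss_int_intr (p.2.1%:Z - 6) (p.2.2%:Z - 6)).
apply: (@sub_finite_set _ _ (range F)); last exact/finite_image/finite_finset.
move=> g [[x y] []]; have [s [[a b] [hq ->]]] := affHP g.
have [/intrP[m em] /intrP[n en]] := andP hq; rewrite /= in em en.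
(* one coordinate: t and +-t + p in [-3, 3] leave 13 values for p *)
have ht (t : R) (p : int) : t ^+ 2 <= 9 -> forall s : bool,
    ((-1) ^+ s * t + p%:~R) ^+ 2 <= 9 -> (0 <= p + 6 < 13).
  move=> ht' s' hp; have : (-6%:~R <= p%:~R :> R) && (p%:~R <= 6%:~R :> R).
    have bd (u : R) : u ^+ 2 <= 9 -> -3 <= u <= 3.
      by move=> hu; apply/andP; split; nra.
    have := bd _ ht'; have := bd _ hp.
    by case: s' {hp}; rewrite ?expr0 ?expr1; lra.
  by rewrite -mulrNz !ler_int; lia.
rewrite /sqn /= => hz hg.
have hm : (0 <= m + 6 < 13).
  apply: (ht x m _ s); first by nra.
  have := sqr_ge0 ((-1) ^+ s * y + b); move: hg; rewrite em en.
  by case: s; rewrite ?expr0 ?expr1; simpc => /= h1 h2; lra.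
have hn : (0 <= n + 6 < 13).
  apply: (ht y n _ s); first by nra.
  have := sqr_ge0 ((-1) ^+ s * x + a); move: hg; rewrite em en.
  by case: s; rewrite ?expr0 ?expr1; simpc => /= h1 h2; lra.
have lm : (absz (m + 6)%R < 13)%N by lia.
have ln : (absz (n + 6)%R < 13)%N by lia.
exists (s, (Ordinal lm, Ordinal ln)) => //; apply: affH_ext => z /=.
have e1 : (absz (m + 6)%R)%:Z - 6 = m by lia.
have e2 : (absz (n + 6)%R)%:Z - 6 = n by lia.
by rewrite e1 e2 em en.
Qed.

Lemma gauss_round z : exists q, gauss_int q /\ sqn (z - q) <= 9.
Proof.
case: z => x y; exists ((Num.floor x)%:~R +i* (Num.floor y)%:~R).
split; first exact: gauss_int_intr.
rewrite /sqn /=; have /andP := floor_itv x; rewrite intrD => -[].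
have /andP := floor_itv y; rewrite intrD => -[] *; nra.
Qed.

Lemma far_from_int (x : R) : ~~ (x \is a Num.int) ->
  exists2 e : R, 0 < e & forall n : int, e <= (x - n%:~R) ^+ 2.
Proof.
move=> hx; have /andP[h1 h2] := floor_itv x.
have h3 : (Num.floor x)%:~R < x.
  rewrite lt_neqAle h1 andbT; apply: contra hx => /eqP <-; exact: intr_int.
pose e := Num.min (x - (Num.floor x)%:~R) ((Num.floor x + 1)%:~R - x).
have e0 : 0 < e by rewrite lt_min !subr_gt0 h3 h2.
exists (e ^+ 2); first exact: exprn_gt0.
move=> n.
have [hn|hn] := leP n (Num.floor x).
  have : e <= x - (Num.floor x)%:~R by rewrite ge_min lexx.
  have : n%:~R <= (Num.floor x)%:~R :> R by rewrite ler_int.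
  nra.
have : e <= (Num.floor x + 1)%:~R - x by rewrite ge_min lexx orbT.
have : (Num.floor x + 1)%:~R <= n%:~R :> R by rewrite ler_int; lia.
nra.
Qed.

Lemma far_from_gauss z : ~~ gauss_int z ->
  exists2 e : R, 0 < e & forall q, gauss_int q -> e <= sqn (z - q).
Proof.
case: z => x y; rewrite /gauss_int /= negb_and.
case/orP => /far_from_int[e e0 he]; exists e => // -[a b];
  move=> /andP[/= /intrP[m ->] /intrP[n ->]]; rewrite /sqn /=.
  have := he m; have := sqr_ge0 (y - n%:~R); lra.
have := he n; have := sqr_ge0 (x - m%:~R); lra.
Qed.

(** The orbit of z is the union of the lattice cosets z + Z[i] and -z + Z[i];
    a point outside of it differs from both by a number which is not a Gaussian
    integer. *)
Lemma orbit_separated z w : (forall g, g z != w) ->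
  exists2 e : R, 0 < e & forall g, e <= sqn (g z - w).
Proof.
move=> H.
have nm : ~~ gauss_int (w - z).
  apply/negP => h; move/eqP: (H (mk_affH false h)); apply.
  by rewrite /= expr0; ring.
have np : ~~ gauss_int (w + z).
  apply/negP => h; move/eqP: (H (mk_affH true h)); apply.
  by rewrite /= expr1; ring.
have [e e0 he] := far_from_gauss nm; have [f f0 hf] := far_from_gauss np.
exists (Num.min e f) => [|g]; first by rewrite lt_min e0.
have [s [q [hq ->]]] := affHP g.
rewrite -sqnN ge_min /=; case: s; apply/orP.
  right; have -> : - ((-1) ^+ true * z + q - w) = w + z - q.
    by rewrite expr1; ring.
  exact: hf.
left; have -> : - ((-1) ^+ false * z + q - w) = w - z - q.
  by rewrite expr0; ring.
exact: he.
Qed.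
End Letters.

(** * Left-infinite words *)

Section Seqs.
Variable A : choiceType.
Implicit Types x y : left_inf A.

Lemma word_cons x n : word x n.+1 = x n :: word x n.
Proof. by rewrite /word mkseqS rev_rcons. Qed.

Lemma size_word x n : size (word x n) = n.
Proof. by rewrite /word size_rev size_mkseq. Qed.

Lemma iter_shiftE x n m : iter n (@seq_shift A) x m = x (n + m)%N.
Proof. by elim: n m => //= n IH m; rewrite /seq_shift IH addnS. Qed.

Lemma eq_word x y n : {in gtn n, x =1 y} -> word x n = word y n.
Proof.
move=> e; congr rev; apply/eq_in_map => i; rewrite mem_iota /= => hi.
exact: e.
Qed.
End Seqs.

(** * The point coded by a left-infinite word *)

Section LimitPoint.
Variable R : realType.
Implicit Types (x y : left_inf 'I_4) (g h : affH R) (z w : R[i]).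

Lemma geometric_cvg (u : R ^nat) (C q : R) : 0 <= q < 1 ->
  (forall n, `|u n.+1 - u n| <= C * q ^+ n) -> cvgn u.
Proof.
move=> /andP[q0 q1] hu.
have C0 : 0 <= C.
  by have := le_trans (normr_ge0 _) (hu 0%N); rewrite expr0 mulr1.
have hs : cvgn (series (telescope u)).
  apply: normed_cvg; apply: (@series_le_cvg _ _ (geometric C q)) => [n|n|n|].
  - exact: normr_ge0.
  - by rewrite /= mulr_ge0 ?exprn_ge0.
  - exact: hu.
  - by apply: is_cvg_geometric_series; rewrite ger0_norm.
have -> : u = (fun n => u 0%N + series (telescope u) n).
  by apply/funext => n; exact: eq_sum_telescope.
by apply: is_cvgD => //; exact: is_cvg_cst.
Qed.

(** Convergence is taken coordinatewise, so that the completeness used is the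
    one of R. *)
Definition cvg_coord (u : nat -> R[i]) z :=
  complex.Re (u n) @[n --> \oo] --> complex.Re z /\
  complex.Im (u n) @[n --> \oo] --> complex.Im z.

Lemma cvg_coord_letter k (u : nat -> R[i]) z : cvg_coord u z ->
  cvg_coord (fun n => letter_map k (u n)) (letter_map k z).
Proof.
have H : exists a b c d e f : R, forall w, letter_map k w =
   (a * complex.Re w + b * complex.Im w + c) +i*
   (d * complex.Re w + e * complex.Im w + f).
  (* the coefficients of a real affine map are read off its values at 0, 1, i *)
  pose L : R[i] -> R[i] := letter_map k.
  exists (complex.Re (L 1 - L 0)), (complex.Re (L 'i - L 0)).
  exists (complex.Re (L 0)), (complex.Im (L 1 - L 0)).
  exists (complex.Im (L 'i - L 0)), (complex.Im (L 0)); rewrite /L {L}.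
  move=> [s t]; rewrite /letter_map invC2.
  by case: k => [[|[|[|[|//]]]] i] /=; simpc => /=; apply/eqP;
    rewrite eq_complex /=; apply/andP; split; apply/eqP; field.
have [a [b [c [d [e [f H']]]]]] := H.
have lin (a' b' c' : R) : cvg_coord u z ->
   a' * complex.Re (u n) + b' * complex.Im (u n) + c' @[n --> \oo] -->
   a' * complex.Re z + b' * complex.Im z + c'.
  move=> [hr hi]; apply: cvgD; last exact: cvg_cst.
  by apply: cvgD; apply: cvgM => //; exact: cvg_cst.
by move=> hu; split; rewrite H' /=; under eq_fun do rewrite H' /=; exact: lin.
Qed.

Lemma cvg_coord_unique (u : nat -> R[i]) z w :
  cvg_coord u z -> cvg_coord u w -> z = w.
Proof.
case: z w => a b [c d] [/= h1 h2] [/= h3 h4].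
by rewrite (cvg_unique _ h1 h3) ?(cvg_unique _ h2 h4).
Qed.

Lemma norm_le_sqrt_half (a : R) n : a ^+ 2 <= 9 / 2 ^+ n ->
  `|a| <= 3 * (Num.sqrt (2^-1)) ^+ n.
Proof.
move=> h; rewrite -ler_sqr ?nnegrE ?mulr_ge0 ?exprn_ge0 ?sqrtr_ge0 //.
rewrite real_normK ?num_real // exprMn exprAC sqr_sqrtr ?invr_ge0 // exprVn.
by move: h; congr (_ <= _); congr (_ / _); rewrite -natrX.
Qed.

Lemma sqn0_le : sqn (0 : R[i]) <= 9.
Proof. by rewrite /sqn /= expr0n addr0. Qed.

Lemma sqn_weval_le v z : sqn z <= 9 -> sqn (weval v z) <= 9.
Proof. by elim: v z => //= k v IH z hz; exact/IH/sqn_letter. Qed.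

Lemma coded_point_ex x : exists z, cvg_coord (fun n => weval (word x n) 0) z.
Proof.
have q01 : 0 <= Num.sqrt (2^-1 : R) < 1.
  by rewrite sqrtr_ge0 -[X in _ < X]sqrtr1 ltr_sqrt //= invf_lt1 ?ltr1n.
(* the two words differ by the letter applied first, hence by a displacement of
   0 inside the disk of radius 3 that the other n letters contract *)
have step n :
    sqn (weval (word x n.+1) 0 - weval (word x n) (0 : R[i])) <= 9 / 2 ^+ n.
  rewrite word_cons /= -/(weval _ _) sqn_weval size_word subr0.
  rewrite ler_pM2r ?invr_gt0 ?exprn_gt0 //.
  exact/sqn_letter/sqn0_le.
have cr : cvgn (fun n => complex.Re (weval (word x n) (0 : R[i]))).
  apply: (geometric_cvg (C := 3) q01) => n; apply: norm_le_sqrt_half.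
  apply: le_trans (step n); rewrite /sqn raddfB /=.
  by rewrite lerDl sqr_ge0.
have ci : cvgn (fun n => complex.Im (weval (word x n) (0 : R[i]))).
  apply: (geometric_cvg (C := 3) q01) => n; apply: norm_le_sqrt_half.
  apply: le_trans (step n); rewrite /sqn !raddfB /=.
  by rewrite lerDr sqr_ge0.
by eexists (Complex _ _); split; [exact: cr|exact: ci].
Qed.

Definition coded_point x : R[i] := projT1 (cid (coded_point_ex x)).

Lemma coded_pointP x : cvg_coord (fun n => weval (word x n) 0) (coded_point x).
Proof. by rewrite /coded_point; case: cid. Qed.

(** This equation and the bound [sqn_coded_point] determine the coded point,
    and everything below is derived from the two. *)
Lemma coded_point_rec x :
  coded_point x = letter_map (x 0%N) (coded_point (seq_shift x)).
Proof.
apply: (@cvg_coord_unique (fun n => weval (word x n.+1) 0)).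
  have [hr hi] := coded_pointP x.
  by split; [move: hr | move: hi]; rewrite -cvg_shiftS; apply.
have -> : (fun n => weval (word x n.+1) 0) =
   (fun n => letter_map (x 0%N) (weval (word (seq_shift x) n) (0:R[i]))).
  by apply/funext => n; rewrite word_S /weval foldl_rcons.
exact/cvg_coord_letter/coded_pointP.
Qed.

Lemma sqn_coded_point x : sqn (coded_point x) <= 9.
Proof.
have [hr hi] := coded_pointP x.
have hc :
    sqn (weval (word x n) (0 : R[i])) @[n --> \oo] --> sqn (coded_point x).
  by rewrite /sqn !expr2; under eq_fun do rewrite !expr2;
    apply: cvgD; exact: cvgM.
apply: (closed_cvg (fun t : R => t <= 9) (@closed_le _ 9) _ _ hc).
apply: nearW => n; exact/sqn_weval_le/sqn0_le.
Qed.

Lemma coded_point_iter x n :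
  coded_point x = weval (word x n) (coded_point (iter n (@seq_shift _) x)).
Proof.
elim: n => //= n ->; rewrite word_cons /= -/(weval _ _) coded_point_rec.
by rewrite iter_shiftE addn0.
Qed.

End LimitPoint.

(** * Asymptotic equivalence *)

Section Equivalence.
Variable R : realType.
Implicit Types (x y : left_inf 'I_4) (g h : affH R) (z w : R[i]).
Local Notation P := (coded_point R).
Local Notation tail n x := (iter n (@seq_shift _) x).

Lemma pow2_small (C e : R) : 0 < e -> exists n : nat, C / 2 ^+ n < e.
Proof.
move=> e0; exists (Num.bound (C / e)).
have [hC|hC] := leP C 0.
  by apply: le_lt_trans e0; rewrite pmulr_lle0 // invr_gt0 exprn_gt0.
rewrite ltr_pdivrMr ?exprn_gt0 // mulrC -ltr_pdivrMr //.
apply: lt_trans (archi_boundP _) _; first by rewrite divr_ge0 // ltW.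
by rewrite -natrX ltr_nat ltn_expl.
Qed.

(** As g is an isometry, g z stays within 3 of g 0, which takes finitely many
    values. *)
Lemma finite_affH_bounded (D : set (affH R)) : finite_set D ->
  exists C : R, forall g z w, D g -> sqn z <= 9 -> sqn w <= 9 ->
    sqn (g z - w) <= C.
Proof.
move=> /finite_seqP[s ->].
pose M := \big[Num.max/0]_(g <- s) sqn (g 0).
(* 54 = 2 * (2 * 9) + 2 * 9, from the bound for g z and the one for w *)
exists (4 * M + 54) => g z w /= gs hz hw.
have hM : sqn (g 0) <= M.
  exact: (le_bigmax_seq 0 g xpredT (fun g : affH R => sqn (g 0))).
have h1 := sqnB_le (g z) w.
have h2 : sqn (g z) <= 2 * sqn (g z - g 0) + 2 * sqn (- g 0).
  by have := sqnB_le (g z - g 0) (- g 0); rewrite opprK subrK.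
have h3 : sqn (g z - g 0) = sqn z by rewrite sqn_affH subr0.
have h4 := sqnN (g 0); lra.
Qed.

Lemma asymp_side x y : asymp R x y -> side \o x =1 side \o y.
Proof.
move=> /asboolP[g [_ e]] n /=.
have := congr1 (map side) (e n.+1); rewrite map_side_act !word_cons /=.
by case.
Qed.

(** For each n the points of x and of some h . y are images of two points at
    bounded distance under the same contraction x_n ... x_1. So the orbit of
    the point of y comes arbitrarily close to the point of x, and it is
    discrete. *)
Lemma asymp_orbit x y : asymp R x y -> exists h : affH R, h (P y) = P x.
Proof.
move=> /asboolP[g [fg e]]; apply: contrapT => H.
have [|d d0 hd] := @orbit_separated R (P y) (P x).
  by move=> h; apply/eqP => eh; apply: H; exists h.
have [C hC] := finite_affH_bounded fg; have [n hn] := pow2_small C d0.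
have [h eh] := weval_act (g n) (word x n).
have := hd h.
rewrite [P y](coded_point_iter _ _ n) [P x](coded_point_iter _ _ n).
rewrite -e -eh sqn_weval size_word; apply/negP; rewrite -ltNge.
apply: le_lt_trans hn; rewrite ler_pM2r ?invr_gt0 ?exprn_gt0 //.
by apply: hC; rewrite ?sqn_coded_point //; exists n.
Qed.

(** Lifting h letter by letter gives g_n with g_n . x_n ... x_1 = y_n ... y_1 h.
    As letters are injective, g_n maps the point coded by the n-th tail of y to
    the one coded by the n-th tail of x; both are in the disk of radius 3, which
    leaves finitely many g_n. *)
Lemma orbit_asymp x y h :
  side \o x =1 side \o y -> h (P y) = P x -> asymp R x y.
Proof.
move=> exy eh.
pose Q n g :=
  g (P (tail n y)) = P (tail n x) /\ word_act g (word x n) = word y n.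
have [g hg] : exists g : nat -> affH R, forall n, Q n (g n).
  suff: forall n, exists g, Q n g by move=> /choice[g hg]; exists g.
  elim=> [|n [g [eg ew]]]; first by exists h.
  have [g' eg'] := lift_letter g (exy n).
  exists g'; split; last first.
    have -> : word_act g' (word x n.+1) = y n :: word_act g (word x n).
      rewrite word_cons /= (@wreath_uniq _ g' (x n) (y n) g) //.
      exact/funext.
    by rewrite word_cons ew.
  apply: (@letter_inj R (x n)); rewrite eg' /=.
  move: eg; rewrite [P (tail n y)]coded_point_rec [P (tail n x)]coded_point_rec.
  by rewrite !iter_shiftE !addn0.
apply/asboolP; exists g; split=> [|n]; last by have [] := hg n.
apply: sub_finite_set (affH_bounded_finite R) => _ [n _ <-].
by exists (P (tail n y)); have [-> _] := hg n; rewrite !sqn_coded_point.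
Qed.

End Equivalence.

(** * Compact and Hausdorff spaces *)

Lemma compact_homeomorphism (S T : topologicalType) (f : S -> T) :
  compact [set: S] -> hausdorff_space T -> continuous f -> injective f ->
  (forall q, exists p, f p = q) -> homeomorphism f.
Proof.
move=> cS hT cf injf surj; split => //.
have [g fg] := choice surj; have gf : cancel f g by move=> p; apply: injf.
exists g; split => //; apply/continuous_closedP => C clC.
have -> : g @^-1` C = f @` C.
  by apply/seteqP; split=> [q Cq|_ [p Cp <-]] /=; [exists (g q)|rewrite gf].
apply: compact_closed => //; apply: continuous_compact.
  exact: continuous_subspaceT.
exact: subclosed_compact cS _.
Qed.

Lemma hausdorff_prod (S T : topologicalType) :
  hausdorff_space S -> hausdorff_space T -> hausdorff_space (S * T)%type.
Proof.
move=> hS hT [p p'] [q q'] cl; congr pair.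
  apply: hS => A B nA nB.
  have [[a b] [/= Aa Ba]] := cl _ _ (@cvg_fst _ _ (nbhs p) (nbhs p') _ A nA)
    (@cvg_fst _ _ (nbhs q) (nbhs q') _ B nB).
  by exists a.
apply: hT => A B nA nB.
have [[a b] [/= Ab Bb]] := cl _ _ (@cvg_snd _ _ (nbhs p) (nbhs p') _ A nA)
  (@cvg_snd _ _ (nbhs q) (nbhs q') _ B nB).
by exists b.
Qed.

(** * Topology of the spaces of left-infinite sequences *)

Section LeftInf.
Variable A : choiceType.

Lemma near_prefix (x : left_inf A) n :
  nbhs x [set y : left_inf A | {in gtn n, x =1 y}].
Proof.
elim: n => [|n IH]; first by apply: filterS filterT => y _ m.
have h : nbhs x [set y : left_inf A | x n = y n].
  pose pr := @proj nat (fun=> discrete_topology A) n.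
  apply: (@filterS _ (nbhs x) _ (pr @^-1` [set x n])).
    by move=> y /=; rewrite /pr /proj => ->.
  exact: (@proj_continuous nat (fun=> discrete_topology A) n x _
    (discrete_set1 _)).
apply: filterS2 IH h => y hy e m.
by rewrite inE ltnS leq_eqVlt => /orP[/eqP ->//|]; exact: hy.
Qed.

Lemma continuous_left_inf (S : topologicalType) (F : S -> left_inf A) :
  (forall n, continuous (fun s => F s n : discrete_topology A)) -> continuous F.
Proof.
move=> cF s.
by apply/(@pointwise_cvgP nat (discrete_topology A)) => n; exact: cF.
Qed.

Lemma hausdorff_left_inf : hausdorff_space (left_inf A).
Proof.
by apply: (@hausdorff_product nat (fun=> discrete_topology A)) => n;
  exact: discrete_hausdorff.
Qed.
End LeftInf.

Lemma compact_left_inf (A : finType) : compact [set: left_inf A].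
Proof.
have := @tychonoff nat (fun=> discrete_topology A) (fun=> setT).
have -> :
    [set f : nat -> discrete_topology A | forall i, [set: A] (f i)] = setT.
  by apply/seteqP.
by apply => _; apply: finite_compact; exact: finite_finset.
Qed.

(** * Topology of the plane and of its orbit space *)

Section Plane.
Variable R : realType.
Implicit Types (z w : R[i]^o) (g : affH R).

Lemma norm_lt_sqn (z : R[i]) (r : R) :
  0 < r -> (`|z| < r%:C) = (sqn z < r ^+ 2).
Proof.
move=> r0; rewrite normc_def ltcR -/(sqn z).
rewrite -[in RHS](sqr_sqrtr (sqn_ge0 z)) ltr_sqr ?nnegrE ?sqrtr_ge0 //.
exact: ltW.
Qed.

Lemma nbhs_sqnP z (U : set R[i]^o) :
  nbhs z U <-> exists2 r : R, 0 < r & forall w, sqn (z - w) < r -> U w.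
Proof.
split=> [/nbhs_ballP[[e e'] /= e0 eU]|[r r0 rU]].
  move: e0; rewrite ltcE /= => /andP[/eqP e'0 e0]; rewrite e'0 in eU.
  exists (e ^+ 2) => [|w hw]; first exact: exprn_gt0.
  by apply: eU; rewrite -ball_normE /= (norm_lt_sqn _ e0).
have s0 : 0 < Num.sqrt r by rewrite sqrtr_gt0.
apply/nbhs_ballP; exists (Num.sqrt r)%:C => /=; first by rewrite ltcR.
move=> w; rewrite -ball_normE /= (norm_lt_sqn _ s0) sqr_sqrtr ?ltW //.
exact: rU.
Qed.

Lemma affH_continuous g : continuous (g : R[i]^o -> R[i]^o).
Proof.
move=> z U /nbhs_sqnP[r r0 rU]; apply/nbhs_sqnP; exists r => // w hw.
by apply: rU; rewrite sqn_affH.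
Qed.

Lemma pi_orbitP (z w : R[i]^o) :
  \pi_(orbit_space R) z = \pi_(orbit_space R) w <-> exists g : affH R, g z = w.
Proof.
by split=> [/eqmodP/asboolP|h]; last by apply/eqmodP/asboolP.
Qed.

(** The projection to the orbit space is an open map, because the saturation of
    an open set is the union of its preimages under the elements of H. *)
Lemma pi_orbit_nbhs z (U : set R[i]^o) :
  nbhs z U -> nbhs (\pi_(orbit_space R) z) (\pi_(orbit_space R) @` U).
Proof.
rewrite nbhsE => -[B [oB Bz] BU].
suff oV : open ((\pi_(orbit_space R) : R[i]^o -> orbit_space R) @` B).
  apply: filterS (open_nbhs_nbhs (conj oV _)); last by exists z.
  exact: image_subset.
have -> : open ((\pi_(orbit_space R) : R[i]^o -> orbit_space R) @` B) =
  open ((\pi_(orbit_space R) : R[i]^o -> orbit_space R) @^-1`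
   ((\pi_(orbit_space R) : R[i]^o -> orbit_space R) @` B)) by [].
have -> : (\pi_(orbit_space R) : R[i]^o -> orbit_space R) @^-1`
   ((\pi_(orbit_space R) : R[i]^o -> orbit_space R) @` B) =
   \bigcup_(g in [set: affH R]) (g : R[i]^o -> R[i]^o) @^-1` B.
  apply/seteqP; split=> u /=.
    by move=> [w Bw] /esym/pi_orbitP[g eg]; exists g => //=; rewrite eg.
  by move=> [g _ /= Bg]; exists (g u) => //; apply/esym/pi_orbitP; exists g.
apply: bigcup_open => g _; apply: open_comp => // w _; exact: affH_continuous.
Qed.

Lemma hausdorff_orbit_space : hausdorff_space (orbit_space R).
Proof.
move=> p q; rewrite -[p]reprK -[q]reprK; move: (repr p) (repr q) => z w cl.
apply: contrapT => H.
have [|e e0 he] := @orbit_separated R z w.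
  by move=> g; apply/eqP => eg; apply: H; apply/pi_orbitP; exists g.
(* if two disks of squared radius e / 5 met modulo H, the points g z and w
   would be at squared distance at most 4 e / 5 *)
have e5 : 0 < e / 5 by rewrite divr_gt0.
pose B (v : R[i]^o) : set R[i]^o := [set u | sqn (v - u) < e / 5].
have nB v : nbhs v (B v) by apply/nbhs_sqnP; exists (e / 5).
have [_ [[z' Bz' <-] [w' Bw' /esym/pi_orbitP[g eg]]]] :=
  cl _ _ (pi_orbit_nbhs (nB z)) (pi_orbit_nbhs (nB w)).
have := he g; rewrite leNgt => /negP; apply.
have h1 := sqnB_le (g z - g z') (w - w').
have h2 : g z - g z' - (w - w') = g z - w by rewrite eg; ring.
rewrite h2 sqn_affH in h1; rewrite /B /= in Bz' Bw'; lra.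
Qed.

Lemma coded_point_continuous : continuous (coded_point R : _ -> R[i]^o).
Proof.
(* 36 bounds the squared distance of two points of the disk of radius 3 *)
move=> x U /nbhs_sqnP[r r0 rU]; have [n hn] := pow2_small 36 r0.
apply: filterS (near_prefix x n) => y exy; apply: rU; apply: le_lt_trans hn.
pose tail u := coded_point R (iter n (@seq_shift 'I_4) u).
rewrite [X in X - _](coded_point_iter _ x n) -/(tail x).
rewrite [X in _ - X](coded_point_iter _ y n) -/(tail y).
rewrite -(eq_word exy) sqn_weval size_word ler_pM2r ?invr_gt0 ?exprn_gt0 //.
have := sqnB_le (tail x) (tail y).
have : sqn (tail x) <= 9 by exact: sqn_coded_point.
have : sqn (tail y) <= 9 by exact: sqn_coded_point.
lra.
Qed.

(** Take any word v of length n with the prescribed summands and write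
    z = v(w0). Reducing w0 modulo H to a bounded point costs an element g of H,
    and g . v is another word with the same summands. Whatever letters of the
    prescribed summands are put to the left of g . v, the coded point is then
    close to z modulo H. *)
Lemma coded_point_dense z (t : left_inf bool) (r : R) : 0 < r ->
  exists (x : left_inf 'I_4) (h : affH R),
    side \o x =1 t /\ sqn (z - h (coded_point R x)) < r.
Proof.
move=> r0; have [n hn] := pow2_small 36 r0.
pose base (b : bool) : 'I_4 := if b then @Ordinal 4 0 isT else @Ordinal 4 2 isT.
have baseK b : side (base b) = b by case: b.
pose x0 : left_inf 'I_4 := fun m => base (t m).
have [w0 ew0] := weval_surj (word x0 n) z.
have [q [hq hw]] := gauss_round w0.
pose g := mk_affH false hq; have eg : g (w0 - q) = w0 by rewrite /= expr0; ring.
have [h eh] := weval_act g (word x0 n).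
pose v := word_act g (word x0 n).
have sv : size v = n by rewrite /v word_act_size size_word.
pose x : left_inf 'I_4 :=
  fun m => if (m < n)%N then nth (base true) (rev v) m else x0 m.
have ex : word x n = v.
  rewrite /word -[RHS]revK; congr rev.
  apply: (@eq_from_nth _ (base true)); first by rewrite size_mkseq size_rev sv.
  by move=> i; rewrite size_mkseq => hi; rewrite nth_mkseq // /x hi.
exists x, h; split.
  move=> m /=; rewrite /x; case: ifP => hm; last exact: baseK.
  rewrite -(nth_map _ true) ?size_rev ?sv // map_rev map_side_act -map_rev revK.
  by rewrite -map_comp nth_mkseq //= baseK.
have -> : z = h (weval v (w0 - q)) by rewrite -eh eg.
apply: le_lt_trans hn.
rewrite sqn_affH (coded_point_iter _ x n) ex sqn_weval sv.
rewrite ler_pM2r ?invr_gt0 ?exprn_gt0 //.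
have := sqnB_le (w0 - q) (coded_point R (iter n (@seq_shift _) x)).
have := sqn_coded_point R (iter n (@seq_shift _) x); lra.
Qed.
End Plane.

(** * The coding of the limit space *)

Section Coding.
Variable R : realType.
Implicit Types (x y : left_inf 'I_4) (g h : affH R) (z w : R[i]).

Definition coding x : (orbit_space R * left_inf bool)%type :=
  (\pi_(orbit_space R) (coded_point R x), side \o x).

Lemma coding_continuous : continuous coding.
Proof.
have c1 : continuous
    (fun x => \pi_(orbit_space R) (coded_point R x) : orbit_space R).
  move=> x; apply: (@continuous_comp _ R[i]^o (orbit_space R) (coded_point R)).
    exact: coded_point_continuous.
  exact: pi_continuous.
have c2 : continuous (fun x : left_inf 'I_4 => (side \o x : left_inf bool)).
  apply: continuous_left_inf => n x U /= nU.
  apply: filterS (near_prefix x n.+1) => y /= e; rewrite -e ?inE //.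
  exact: nbhs_singleton nU.
move=> x; exact: (cvg_pair (c1 x) (c2 x)).
Qed.

Lemma codingP x y : reflect (coding x = coding y) (asymp R x y).
Proof.
apply: (iffP idP) => [e|[/pi_orbitP[h eh] es]].
  congr pair; last by apply/funext; exact: asymp_side e.
  by have [h eh] := asymp_orbit e; apply/esym/pi_orbitP; exists h.
rewrite asymp_sym; apply: (orbit_asymp _ eh) => n.
by move/(congr1 (fun f => f n)): es.
Qed.

(** The range is closed, being compact in a Hausdorff space, and it is dense. *)
Lemma coding_surj q : exists x, coding x = q.
Proof.
have cl : closed (range coding).
  apply: compact_closed.
    by apply: hausdorff_prod;
      [exact: hausdorff_orbit_space|exact: hausdorff_left_inf].
  apply: continuous_compact; last exact: compact_left_inf.
  exact/continuous_subspaceT/coding_continuous.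
suff [x _ ex] : range coding q by exists x.
apply: cl => W; case: q => p t; rewrite -[p]reprK; move: (repr p) => z.
move=> [[U V] /= [nU nV] UV].
have := @pi_continuous _ _ z U nU => /nbhs_sqnP[r r0 rU].
have [x [h [ext hx]]] := coded_point_dense z t r0.
exists (coding x); split; first by exists x.
apply: UV; split => /=; last first.
  have -> : side \o x = t by apply/funext.
  exact: nbhs_singleton nV.
have -> : \pi_(orbit_space R) (coded_point R x) =
    \pi_(orbit_space R) (h (coded_point R x)).
  by apply/pi_orbitP; exists h.
exact: rU.
Qed.

(** Deleting the last letter inverts it, and modulo H its inverse is the
    multiplication by [dilation] of its summand. *)
Lemma coding_shift x z :
  \pi_(orbit_space R) (coded_point R x) = \pi_(orbit_space R) z ->
  coding (seq_shift x) =
    (\pi_(orbit_space R) (dilation R (side (x 0%N)) * z),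
     seq_shift (side \o x)).
Proof.
move=> /pi_orbitP[g <-]; congr pair; apply/pi_orbitP.
have [u eu] := dilation_letter R (x 0%N).
have [h eh] := dilation_affH (side (x 0%N)) g.
by exists (u * h)%g; rewrite eh [coded_point R x]coded_point_rec eu.
Qed.

End Coding.

Theorem corollary4p6 (R : realType) :
  exists f : limit_space R -> (orbit_space R * left_inf bool)%type,
    homeomorphism f /\
    forall (p : limit_space R) (z : R[i]) (y : left_inf bool),
      f p = (\pi_(orbit_space R) z, y) ->
      (y 0%N = letterL ->
         f (limit_shift p) = (\pi_(orbit_space R) ((1 - 'i) * z), seq_shift y)) /\
      (y 0%N = letterR ->
         f (limit_shift p) = (\pi_(orbit_space R) ((1 + 'i) * z), seq_shift y)).
Proof.
pose f : limit_space R -> (orbit_space R * left_inf bool)%type :=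
  coding R \o repr.
have fE x : f (\pi_(limit_space R) x) = coding R x.
  by apply/esym/codingP; have /esym/eqmodP := reprK (\pi_(limit_space R) x).
exists f; split.
  apply: compact_homeomorphism.
  - have -> : [set: limit_space R] =
        range (\pi_(limit_space R) : left_inf 'I_4 -> limit_space R).
      by apply/seteqP; split=> // p _; exists (repr p) => //; exact: reprK.
    apply: continuous_compact; last exact: compact_left_inf.
    exact/continuous_subspaceT/pi_continuous.
  - by apply: hausdorff_prod;
      [exact: hausdorff_orbit_space|exact: hausdorff_left_inf].
  - apply/quotient_continuous.
    have -> : f \o \pi_(limit_space R) = coding R by apply/funext.
    exact: coding_continuous.
  - move=> p q /codingP e; rewrite -[p]reprK -[q]reprK; exact/eqmodP.
  - move=> q; have [x <-] := coding_surj q.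
    by exists (\pi_(limit_space R) x); exact: fE.
move=> p z y; rewrite -[p]reprK limit_shiftE !fE => -[ez <-].
by rewrite (coding_shift ez) /=; split=> ->.
Qed.
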